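(* Consider the optimization problem, the barrier $b$ and the iterates generated by the algorithm described in the context, under the assumptions stated there. If the algorithm runs indefinitely, then $$-\frac{\mu_k}{\alpha_k}\,b^*\!\left(\frac{\alpha_k}{\mu_k}\right)\searrow 0\quad\text{as }k\to\infty.$$ Moreover, any feasible accumulation point of $(x^k)$ that belongs to $\operatorname{dom}q$ is asymptotically KKT-optimal for the problem.
   Context: Problem: minimize $q(x)$ over $x\in\mathbb{R}^n$ subject to $c(x)\le 0$, $c^{\rm eq}(x)=0$, where $q:\mathbb{R}^n\to\mathbb{R}\cup\{\pm\infty\}$ is proper and lower semicontinuous, $c:\mathbb{R}^n\to\mathbb{R}^m$ and $c^{\rm eq}:\mathbb{R}^n\to\mathbb{R}^{m_{\rm eq}}$ are continuously differentiable, and the infimum is finite. A point $\bar x$ is feasible if $c(\bar x)\le0$ and $c^{\rm eq}(\bar x)=0$. $\partial$ is the limiting (Mordukhovich) subdifferential, $J$ the Jacobian, $[r]_+=\max\{0,r\}$, $[r]_-=\max\{0,-r\}$ (elementwise on vectors). Asymptotic KKT optimality: $\bar x\in\mathbb{R}^n$ is asymptotically KKT-optimal if $\bar x\in\operatorname{dom}q$ and there exist sequences $\xi^k\to\bar x$ in $\mathbb{R}^n$, $(\eta^k)\subset\mathbb{R}^m$ and $(\eta^{{\rm eq},k})\subset\mathbb{R}^{m_{\rm eq}}$ such that $\operatorname{dist}(-Jc(\xi^k)^\top\eta^k-Jc^{\rm eq}(\xi^k)^\top\eta^{{\rm eq},k},\partial q(\xi^k))\to0$, $[c(\xi^k)]_+\to0$,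 $c^{\rm eq}(\xi^k)\to0$, and for all $k$: $\eta^k\ge0$ and $\eta^k_ic_i(\bar x)=0$ for $i=1,\dots,m$. Barrier: $b:\mathbb{R}\to\mathbb{R}\cup\{\pm\infty\}$ is proper, lower semicontinuous, twice continuously differentiable on its domain $\operatorname{dom}b=(-\infty,0)$, with $b'>0$ and $b''>0$ there. $b^*(\tau)=\sup_t\{\tau t-b(t)\}$ is its convex conjugate. For $\rho^*>0$: $\psi_{\rho^*}(t)=\min_{z\ge0}\{\rho^*z+b(t-z)\}$, $\psi^{\rm eq}_{\rho^*}(t)=\min_{z\in\mathbb{R}}\{\rho^*z+b(t-z)+b(-t-z)\}$. For $\alpha,\mu>0$: $F_{\alpha,\mu}(x)=q(x)+\mu\sum_{i=1}^m\psi_{\alpha/\mu}(c_i(x))+\mu\sum_{j=1}^{m_{\rm eq}}\psi^{\rm eq}_{\alpha/\mu}(c^{\rm eq}_j(x))$. Algorithm: given $\epsilon_{\rm p},\epsilon_{\rm d}\ge0$, $\alpha_0,\mu_0>0$, $\varepsilon_0\ge\epsilon_{\rm d}$, $\delta_\alpha>1$, $\delta_\varepsilon,\delta_\mu\in(0,1)$, repeat for $k=0,1,\dots$: 1. Find (any) $x^k$ with $\operatorname{dist}(0,\partial F_{\alpha_k,\mu_k}(x^k))\le\varepsilon_k$ (such a point is assumed to exist; distance to $\emptyset$ is $\infty$). 2. Set $y^k_i=\mu_k\psi_{\alpha_k/\mu_k}'(c_i(x^k))$, $i=1,\dots,m$, and $y^{{\rm eq},k}_j=\mu_k(\psi^{\rm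 eq}_{\alpha_k/\mu_k})'(c^{\rm eq}_j(x^k))$, $j=1,\dots,m_{\rm eq}$. 3. Set $p_k=\max\{\|[c(x^k)]_+\|_\infty,\|c^{\rm eq}(x^k)\|_\infty\}$. 4. Let $s_k$ be the maximum absolute value, over all $i=1,\dots,m$ and $j=1,\dots,m_{\rm eq}$, of the quantities $\min\{y^k_i,[c_i(x^k)]_-\}$, $\min\{\alpha_k-y^k_i,[c_i(x^k)]_+\}$, $\min\{\alpha_k+y^{{\rm eq},k}_j,[c^{\rm eq}_j(x^k)]_-\}$, $\min\{\alpha_k-y^{{\rm eq},k}_j,[c^{\rm eq}_j(x^k)]_+\}$. 5. If $\varepsilon_k\le\epsilon_{\rm d}$, $p_k\le\epsilon_{\rm p}$ and $s_k\le\epsilon_{\rm p}$, stop and return $(x^k,y^k)$. 6. Set $\varepsilon_{k+1}=\max\{\delta_\varepsilon\varepsilon_k,\epsilon_{\rm d}\}$. 7. If $p_k>\max\bigl\{\epsilon_{\rm p},\,2(m+m_{\rm eq})\frac{-b^*(\alpha_k/\mu_k)}{\alpha_k/\mu_k}\bigr\}$ set $\alpha_{k+1}=\delta_\alpha\alpha_k$, else $\alpha_{k+1}=\alpha_k$. 8. If $s_k>\epsilon_{\rm p}$ or $\alpha_{k+1}=\alpha_k$ set $\mu_{k+1}=\delta_\mu\mu_k$, else $\mu_{k+1}=\mu_k$.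
   Formalization: The accumulation-point claim is proved except when $\epsilon_{\rm p}=0<\epsilon_{\rm d}$, where it is false (the dual residual need not vanish); ''$\searrow 0$'' is read as convergence to 0 with strict decrease for all sufficiently large $k$. *)

(* Defs.v *)
From HB Require Import structures.
From mathcomp Require Import all_boot all_order all_algebra.
From mathcomp Require Import all_classical all_reals all_analysis.

Set Implicit Arguments.
Unset Strict Implicit.
Unset Printing Implicit Defensive.

Import Order.TTheory GRing.Theory Num.Theory.
Import numFieldTopology.Exports numFieldNormedType.Exports.

Local Open Scope classical_set_scope.
Local Open Scope ring_scope.

(** Vectors of R^n are row vectors ['rV[R]_n].  The library norm [`|x|] on them
    is the sup norm, so the inner product, the Euclidean norm and the Euclidean
    distance are defined here. *)

Section euclidean.
Context {R : realType} {n : nat}.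
Implicit Types (x y : 'rV[R]_n) (A : set 'rV[R]_n).

Definition inner x y : R := \sum_(i < n) x ord0 i * y ord0 i.

Definition enorm x : R := Num.sqrt (inner x x).

(* equals +oo when [A] is empty *)
Definition dist x A : \bar R := ereal_inf [set (enorm (x - v))%:E | v in A].

End euclidean.

Section extended_real_valued_functions.
Context {R : realType}.

Definition dom (T : Type) (f : T -> \bar R) : set T := [set x | (f x < +oo)%E].

Definition proper (T : Type) (f : T -> \bar R) : Prop :=
  (forall x, f x != -oo%E) /\ dom f !=set0.

Definition conjugate (f : R -> \bar R) (tau : R) : \bar R :=
  ereal_sup [set ((tau * t)%:E - f t)%E | t in setT].

Context {n : nat}.
Implicit Types (f : 'rV[R]_n -> \bar R) (x v : 'rV[R]_n).

Definition regular_subdifferential f x : set 'rV[R]_n :=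
  [set v | f x \is a fin_num /\
    (0 <= limf_einf (fun z : 'rV[R]_n =>
            (f z - f x - (inner v (z - x))%:E) * ((enorm (z - x))^-1)%:E) x^')%E].

Definition subdifferential f x : set 'rV[R]_n :=
  [set v | f x \is a fin_num /\
    exists (z w : nat -> 'rV[R]_n),
      [/\ z @ \oo --> x,
          f \o z @ \oo --> f x,
          forall j, regular_subdifferential f (z j) (w j) &
          w @ \oo --> v]].

End extended_real_valued_functions.

Section smooth_maps.
Context {R : realType} {n m : nat}.

Definition continuously_differentiable (c : 'rV[R]_n -> 'rV[R]_m) : Prop :=
  (forall x, differentiable c x) /\ continuous (fun x => 'J c x : 'M[R]_(n, m)).

(* The library's ['J c x] acts on row vectors from the right, so it is the
   transpose of the usual m x n Jacobian Jc(x); the row vector [jacT c x eta] is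
   Jc(x)^T eta. *)
Definition jacT (c : 'rV[R]_n -> 'rV[R]_m) (x : 'rV[R]_n) (eta : 'rV[R]_m) :
    'rV[R]_n :=
  eta *m ('J c x)^T.

End smooth_maps.

Section parts.
Context {R : realType}.

Definition pos (r : R) : R := Num.max 0 r.
Definition neg (r : R) : R := Num.max 0 (- r).

Definition posv {m : nat} (u : 'rV[R]_m) : 'rV[R]_m := map_mx pos u.

End parts.

Section problem.
Context {R : realType} {n m meq : nat}.
Variables (q : 'rV[R]_n -> \bar R).
Variables (c : 'rV[R]_n -> 'rV[R]_m) (ceq : 'rV[R]_n -> 'rV[R]_meq).

Definition feasible : set 'rV[R]_n :=
  [set x | (forall i, c x ord0 i <= 0) /\ ceq x = 0].

Record problem_assumptions : Prop := ProblemAssumptions {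
  q_proper : proper q;
  q_lsc : lower_semicontinuous q;
  c_smooth : continuously_differentiable c;
  ceq_smooth : continuously_differentiable ceq;
  infimum_finite : ereal_inf [set q x | x in feasible] \is a fin_num }.

Definition asymptotically_KKT_optimal (xbar : 'rV[R]_n) : Prop :=
  dom q xbar /\
  exists (xi : nat -> 'rV[R]_n) (eta : nat -> 'rV[R]_m)
         (etaeq : nat -> 'rV[R]_meq),
    [/\ xi @ \oo --> xbar,
        (fun k => dist (- jacT c (xi k) (eta k) - jacT ceq (xi k) (etaeq k))
                       (subdifferential q (xi k))) @ \oo --> 0%E,
        (fun k => posv (c (xi k))) @ \oo --> (0 : 'rV[R]_m),
        (fun k => ceq (xi k)) @ \oo --> (0 : 'rV[R]_meq) &
        forall k i, 0 <= eta k ord0 i /\ eta k ord0 i * c xbar ord0 i = 0].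

End problem.

Section barrier.
Context {R : realType}.
Variable b : R -> \bar R.

(* [fine \o b] is the real-valued function that agrees with b on its domain. *)
Record barrier_assumptions : Prop := BarrierAssumptions {
  b_proper : proper b;
  b_lsc : lower_semicontinuous b;
  b_dom : dom b = [set t | t < 0];
  b_C2 : forall t, t < 0 ->
    [/\ derivable (fine \o b) t 1,
        derivable (fine \o b)^`()%classic t 1 &
        {for t, continuous (fine \o b)^`(2)%classic}];
  b_d1_gt0 : forall t, t < 0 -> 0 < (fine \o b)^`()%classic t;
  b_d2_gt0 : forall t, t < 0 -> 0 < (fine \o b)^`(2)%classic t }.

(* These minima are attained for every rho > inf b' (resp. rho > 2 inf b');
   they are written as infima in the extended reals so as to be total. *)
Definition psi (rho t : R) : \bar R :=
  ereal_inf [set ((rho * z)%:E + b (t - z))%E | z in [set z | 0 <= z]].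

Definition psieq (rho t : R) : \bar R :=
  ereal_inf [set ((rho * z)%:E + b (t - z) + b (- t - z))%E | z in setT].

Definition scaled_conjugate (alpha mu : R) : \bar R :=
  ((- (mu / alpha))%:E * conjugate b (alpha / mu))%E.

End barrier.

Section algorithm.
Context {R : realType} {n m meq : nat}.
Variables (q : 'rV[R]_n -> \bar R).
Variables (c : 'rV[R]_n -> 'rV[R]_m) (ceq : 'rV[R]_n -> 'rV[R]_meq).
Variable b : R -> \bar R.

Definition penalty_barrier (alpha mu : R) (x : 'rV[R]_n) : \bar R :=
  (q x + mu%:E * (\sum_(i < m) psi b (alpha / mu) (c x ord0 i))
       + mu%:E * (\sum_(j < meq) psieq b (alpha / mu) (ceq x ord0 j)))%E.

Definition multiplier (alpha mu : R) (x : 'rV[R]_n) : 'rV[R]_m :=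
  \row_i (mu * (fine \o psi b (alpha / mu))^`()%classic (c x ord0 i)).

Definition multipliereq (alpha mu : R) (x : 'rV[R]_n) : 'rV[R]_meq :=
  \row_j (mu * (fine \o psieq b (alpha / mu))^`()%classic (ceq x ord0 j)).

Definition infeasibility (x : 'rV[R]_n) : R :=
  Num.max `|posv (c x)| `|ceq x|.

Definition slackness (alpha : R) (x : 'rV[R]_n) (y : 'rV[R]_m)
    (yeq : 'rV[R]_meq) : R :=
  Num.max
    (\big[Num.max/0]_(i < m)
       Num.max `|Num.min (y ord0 i) (neg (c x ord0 i))|
               `|Num.min (alpha - y ord0 i) (pos (c x ord0 i))|)
    (\big[Num.max/0]_(j < meq)
       Num.max `|Num.min (alpha + yeq ord0 j) (neg (ceq x ord0 j))|
               `|Num.min (alpha - yeq ord0 j) (pos (ceq x ord0 j))|).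

Record alg_params : Type := MkAlgParams {
  eps_p : R;
  eps_d : R;
  alpha0 : R;
  mu0 : R;
  eps0 : R;
  delta_alpha : R;
  delta_eps : R;
  delta_mu : R }.

Record alg_params_assumptions (P : alg_params) : Prop := AlgParamsAssumptions {
  eps_p_ge0 : 0 <= eps_p P;
  eps_d_ge0 : 0 <= eps_d P;
  alpha0_gt0 : 0 < alpha0 P;
  mu0_gt0 : 0 < mu0 P;
  eps0_ge : eps_d P <= eps0 P;
  delta_alpha_gt1 : 1 < delta_alpha P;
  delta_eps_in01 : 0 < delta_eps P < 1;
  delta_mu_in01 : 0 < delta_mu P < 1 }.

Definition infeasibility_threshold (P : alg_params) (alpha mu : R) : \bar R :=
  maxe (eps_p P)%:E
    ((2 * (m + meq)%N%:R)%:E *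
       (- conjugate b (alpha / mu) * ((alpha / mu)^-1)%:E))%E.

Record runs_indefinitely (P : alg_params) (x : nat -> 'rV[R]_n)
    (y : nat -> 'rV[R]_m) (yeq : nat -> 'rV[R]_meq)
    (alpha mu eps p s : nat -> R) : Prop := RunsIndefinitely {
  run_alpha0 : alpha 0%N = alpha0 P;
  run_mu0 : mu 0%N = mu0 P;
  run_eps0 : eps 0%N = eps0 P;
  run_x : forall k,
    (dist 0 (subdifferential (penalty_barrier (alpha k) (mu k)) (x k))
       <= (eps k)%:E)%E;
  run_y : forall k, y k = multiplier (alpha k) (mu k) (x k);
  run_yeq : forall k, yeq k = multipliereq (alpha k) (mu k) (x k);
  run_p : forall k, p k = infeasibility (x k);
  run_s : forall k, s k = slackness (alpha k) (x k) (y k) (yeq k);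
  run_nostop : forall k,
    ~ [/\ eps k <= eps_d P, p k <= eps_p P & s k <= eps_p P];
  run_eps : forall k, eps k.+1 = Num.max (delta_eps P * eps k) (eps_d P);
  run_alpha : forall k,
    alpha k.+1 =
      if ((p k)%:E > infeasibility_threshold P (alpha k) (mu k))%E
      then delta_alpha P * alpha k else alpha k;
  run_mu : forall k,
    mu k.+1 =
      if (s k > eps_p P) || (alpha k.+1 == alpha k)
      then delta_mu P * mu k else mu k }.

End algorithm.

(* Main.v *)
(** A barrier satisfying the assumptions blows up at [0] and [b'] is an
    increasing map onto an interval [(r, +oo)].  Hence the supremum [b^* rho] is
    attained at the point [u < 0] with [b' u = rho], and
    [- b^*(rho) / rho = inf_t (b t / rho - t)], which decreases strictly to [0]
    as [rho] tends to [+oo].  The ratio [rho_k = alpha_k / mu_k] grows at least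
    geometrically since at every step either [alpha] is increased or [mu] is
    decreased.

    For large [rho] the minima defining [psi] and [psieq] are attained.  At a
    minimizer the tangents of [b] give an affine minorant of the envelope, while
    freezing the minimizer gives a smooth majorant, so the envelopes are convex
    and differentiable, hence C^1, with [0 < psi' <= rho], [psi' <= b'] and
    [|psieq'| <= rho].  Thus the penalty-barrier function is [q] plus a C^1
    function, and an element [v] of its subdifferential at [x^k] yields
    [v - Jc^T y - Jceq^T yeq] in the subdifferential of [q].

    Along a subsequence converging to a feasible point, the multipliers of the
    inactive constraints vanish: this is clear from [y_i <= mu b'(c_i)] if [mu]
    tends to [0]; otherwise eventually [s <= eps_p < p], which with [p -> 0]
    forces [eps_p = 0] and then [s = 0] leaves no inactive constraint.  So
    [s -> 0] along the subsequence; if [eps_d > 0], the algorithm would stop,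
    and if [eps_d = 0], then [eps -> 0] and dropping the inactive multipliers gives
    the asymptotic KKT conditions. *)

Require Import Defs.
From HB Require Import structures.
From mathcomp Require Import all_boot all_order all_algebra.
From mathcomp Require Import all_classical all_reals all_analysis.
From mathcomp Require Import ring lra.

Set Implicit Arguments.
Unset Strict Implicit.
Unset Printing Implicit Defensive.

Import Order.TTheory GRing.Theory Num.Theory.
Import numFieldTopology.Exports numFieldNormedType.Exports.

Local Open Scope classical_set_scope.
Local Open Scope ring_scope.

(** * The barrier *)

Section barrier_function.
Context {R : realType} (b : R -> \bar R) (Hb : barrier_assumptions b).

Local Notation beta := (fine \o b).
Local Notation beta' := ((fine \o b)^`()%classic).

Lemma barrier_fin t : t < 0 -> b t = (beta t)%:E.
Proof.
move=> t0; rewrite /= fineK// fin_numE (proj1 (b_proper Hb)) -ltey/=.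
by have : dom b t by rewrite (b_dom Hb).
Qed.

Lemma barrier_pinfty t : 0 <= t -> b t = +oo%E.
Proof.
move=> t0; apply/eqP; rewrite eq_le leey/= leNgt; apply/negP => bt.
have : dom b t by [].
by rewrite (b_dom Hb)/= ltNge t0.
Qed.

Lemma barrier_derivable t : t < 0 -> derivable beta t 1.
Proof. by move=> t0; have [] := b_C2 Hb t0. Qed.

Lemma barrier_d1_continuous t : t < 0 -> {for t, continuous beta'}.
Proof.
move=> t0; apply/differentiable_continuous/derivable1_diffP.
by have [] := b_C2 Hb t0.
Qed.

Lemma barrier_MVT u v : u < v -> v < 0 ->
  exists2 w, u < w < v & beta v - beta u = beta' w * (v - u).
Proof.
move=> uv v0.
have [||w] := @MVT _ beta beta' u v uv.
- move=> t; rewrite in_itv/= => /andP[_ tv].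
  by rewrite derive1E; apply/derivableP/barrier_derivable/(lt_trans tv).
- apply: derivable_within_continuous => t; rewrite in_itv/= => /andP[_ tv].
  exact/barrier_derivable/(le_lt_trans tv).
by rewrite in_itv/= => wuv eqw; exists w.
Qed.

Lemma barrier_d1_lt u v : u < v -> v < 0 -> beta' u < beta' v.
Proof.
move=> uv v0; have d2 t : t < 0 -> derivable beta' t 1.
  by move=> t0; have [] := b_C2 Hb t0.
have [||w] := @MVT _ beta' (beta'^`()%classic) u v uv.
- move=> t; rewrite in_itv/= => /andP[_ tv].
  by rewrite derive1E; apply/derivableP/d2/(lt_trans tv).
- apply: derivable_within_continuous => t; rewrite in_itv/= => /andP[_ tv].
  exact/d2/(le_lt_trans tv).
rewrite in_itv/= => /andP[_ wv] eqw; rewrite -subr_gt0 eqw.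
by rewrite mulr_gt0 ?subr_gt0//; apply: (b_d2_gt0 Hb); exact: lt_trans wv v0.
Qed.

Lemma barrier_d1_le u v : u <= v -> v < 0 -> beta' u <= beta' v.
Proof.
rewrite le_eqVlt => /predU1P[->//|uv] v0; exact/ltW/barrier_d1_lt.
Qed.

(** Convexity of [b] on its domain: the slope between the two points is a value of [beta'] in
    between, and [beta'] increases. *)
Lemma barrier_tangent u v : u < 0 -> v < 0 ->
  beta v + beta' v * (u - v) <= beta u.
Proof.
move=> u0 v0; have [uv|vu|->] := ltgtP u v; last by rewrite subrr mulr0 addr0.
- have [w /andP[_ wv] eqw] := barrier_MVT uv v0.
  have : beta' w * (v - u) <= beta' v * (v - u).
    by rewrite ler_wpM2r ?subr_ge0 ?barrier_d1_le// ltW.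
  by rewrite -eqw; lra.
- have [w /andP[vw wu] eqw] := barrier_MVT vu u0.
  have : beta' v * (u - v) <= beta' w * (u - v).
    by rewrite ler_wpM2r ?subr_ge0 ?barrier_d1_le ?(lt_trans wu)// ltW.
  by rewrite -eqw; lra.
Qed.

(** Lower semicontinuity at [0], where [b] is infinite, gives a neighbourhood on which [b] exceeds
    [M]. *)
Lemma barrier_blowup (M : R) : exists2 t, t < 0 &
  forall u, t <= u -> u < 0 -> M < beta u.
Proof.
have : (M%:E < b 0)%E by rewrite barrier_pinfty// ltry.
move=> /(b_lsc Hb)[V /nbhs_ballP[e /= e0 eV] VM].
exists (- (e / 2)) => [|u eu u0]; first by rewrite oppr_lt0 divr_gt0.
rewrite -lte_fin -barrier_fin//; apply/VM/eV.
by rewrite /ball/= sub0r normrN ltr0_norm//; lra.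
Qed.

(** Were [beta'] bounded, [b] would be bounded on [(-1, 0)], an interval of finite length, against
    the blow-up at [0]. *)
Lemma barrier_d1_unbounded (M : R) : exists2 t, t < 0 & M <= beta' t.
Proof.
have [//|bM] := pselect (exists2 t, t < 0 & M <= beta' t).
have [t t0 Mt] := barrier_blowup (beta (-1) + `|M|).
(* [v] is past the blow-up threshold [t] and also right of [-1], so the mean value theorem applies
   between [-1] and [v]. *)
pose v := Num.max t (- 2^-1).
have v0 : v < 0 by rewrite gt_max t0/= oppr_lt0 invr_gt0 ltr0n.
have v1 : -1 < v by rewrite lt_max; apply/orP; right; lra.
have [w /andP[_ wv] eqw] := barrier_MVT v1 v0.
have w0 := lt_trans wv v0.
have wM : beta' w < `|M|.
  rewrite (lt_le_trans _ (ler_norm M))// ltNge; apply/negP => Mw.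
  by apply: bM; exists w.
have : beta' w * (v - -1) <= `|M|.
  rewrite (le_trans _ (ltW wM))// -[leRHS]mulr1.
  by rewrite ler_wpM2l ?(ltW (b_d1_gt0 Hb w0))//; lra.
have : beta (-1) + `|M| < beta v by apply: Mt => //; rewrite le_max lexx.
by lra.
Qed.

Lemma barrier_d1_onto (t rho : R) : t < 0 -> beta' t < rho ->
  exists2 u, t < u < 0 & beta' u = rho.
Proof.
move=> t0 trho; have [v v0 rhov] := barrier_d1_unbounded rho.
have tv : t < v.
  by rewrite ltNge; apply/negP => /barrier_d1_le /(_ t0); lra.
have [||u] := @IVT _ beta' t v rho (ltW tv).
- apply: continuous_in_subspaceT => w; rewrite inE/= in_itv/= => /andP[_ wv].
  exact/barrier_d1_continuous/(le_lt_trans wv).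
- by rewrite ge_min (ltW trho)/= le_max rhov orbT.
rewrite in_itv/= => /andP[tu uv] eqrho; exists u => //.
rewrite (le_lt_trans uv v0) andbT lt_neqAle tu andbT.
by apply/eqP => tuE; move: trho; rewrite tuE eqrho ltxx.
Qed.

End barrier_function.

(** * The marginal functions of the barrier *)

Section convex_derivative.
Context {R : realType}.
Implicit Types (f g u : R -> R) (s t : R).

Lemma is_derive_sub f t (k d : R) : is_derive (t - k) 1 f d ->
  is_derive t 1 (fun s => f (s - k)) d.
Proof.
move=> fd; have sd : is_derive t 1 (fun s => s - k) 1.
  by apply: is_derive_eq; rewrite subr0.
by have := @is_derive1_comp _ f (fun s => s - k) _ _ _ fd sd; rewrite mulr1.
Qed.

Lemma is_derive_opp_sub f t (k d : R) : is_derive (- t - k) 1 f d ->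
  is_derive t 1 (fun s => f (- s - k)) (- d).
Proof.
move=> fd; have sd : is_derive t 1 (fun s => - s - k) (-1).
  by apply: is_derive_eq; rewrite subr0.
by have := @is_derive1_comp _ f (fun s => - s - k) _ _ _ fd sd; rewrite mulrN1.
Qed.

(** [f] is squeezed near [t] between an affine function of slope [d] and [u], so its difference
    quotients are at least as close to [d] as those of [u]. *)
Lemma is_derive_touching f u t (d : R) : is_derive t 1 u d -> f t = u t ->
  (forall s, f t + d * (s - t) <= f s) ->
  (\forall s \near t, f s <= u s) -> is_derive t 1 f d.
Proof.
move=> ud ftu fge fle.
have uq : h^-1 *: ((u \o shift t) (h *: 1) - u t) @[h --> 0^'] --> d.
  rewrite -(@derive_val _ _ _ _ _ _ _ ud).
  exact: (@ex_derive _ _ _ _ _ _ _ ud).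
suff fq : h^-1 *: ((f \o shift t) (h *: 1) - f t) @[h --> 0^'] --> d.
  by apply: DeriveDef; [apply/cvg_ex; exists d|exact: (cvg_lim _ fq)].
have fle0 : \forall h \near 0^', f (h + t) <= u (h + t).
  apply: nbhs_dnbhs; have : (h + t) @[h --> 0] --> t.
    by rewrite -[X in _ --> X]add0r; apply: cvgD; [exact: cvg_id|exact: cvg_cst].
  by move/(_ _ fle).
apply/cvgrPdist_le => e e0; move/cvgrPdist_le : uq => /(_ e e0) uq.
near=> h; have h0 : h != 0 by near: h; exact: nbhs_dnbhs_neq.
have uh : `|d - h^-1 *: ((u \o shift t) (h *: 1) - u t)| <= e.
  by near: h; exact: uq.
apply: le_trans uh.
have fu : f (h + t) <= u (h + t) by near: h.
rewrite /GRing.scale/= !mulr1.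
(* In this form both errors are [h^-1] times a remainder, and the remainder of [f] lies between [0]
   and that of [u]. *)
have E v : d - h^-1 * (v - f t) = - (h^-1 * (v - f t - d * h)).
  by field.
rewrite -ftu !E !normrN !normrM ler_wpM2l//.
by have := fge (h + t); rewrite addrK => fge'; rewrite !ger0_norm; lra.
Unshelve. all: by end_near. Qed.

(** The subgradient inequality at [s], tested at [s + h] and [s - h], traps [g s] between two
    difference quotients of [f] with fixed step, which depend continuously on [s]. *)
Lemma convex_derive_continuous f g : (forall t, is_derive t 1 f (g t)) ->
  (forall s t, f t + g t * (s - t) <= f s) -> continuous g.
Proof.
move=> fg sub t.
have fc : continuous f.
  by move=> s; apply/differentiable_continuous/derivable1_diffP; have [] := fg s.
have fq : h^-1 *: ((f \o shift t) (h *: 1) - f t) @[h --> 0^'] --> g t.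
  rewrite -(@derive_val _ _ _ _ _ _ _ (fg t)).
  exact: (@ex_derive _ _ _ _ _ _ _ (fg t)).
apply/cvgrPdist_le => e e0; have e20 : 0 < e / 2 by rewrite divr_gt0.
move/cvgrPdist_le : fq => /(_ _ e20) /nbhs_ballP[r /= r0 rq].
pose h := r / 2; have h0 : 0 < h by rewrite divr_gt0.
have fshift k : f (s + k) @[s --> t] --> f (t + k).
  have sk : s + k @[s --> t] --> t + k.
    by apply: cvgD; [exact: cvg_id|exact: cvg_cst].
  exact: (cvg_comp _ _ sk (fc _)).
(* Each quotient over [h] involves two values of [f], so this tolerance costs [e / 2]; the other
   [e / 2] is the gap between the quotients at [t] and [g t]. *)
have eh : 0 < e * h / 4 by rewrite divr_gt0// mulr_gt0.
have near_shift k : \forall s \near t, `|f (t + k) - f (s + k)| <= e * h / 4.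
  by move/cvgrPdist_le : (fshift k); exact.
have quot k : k != 0 -> `|k| < r -> `|f (t + k) - f t - g t * k| <= e / 2 * `|k|.
  move=> k0 kr; have := rq k; rewrite /ball/= sub0r normrN => /(_ kr k0).
  rewrite /GRing.scale/= mulr1 [k + t]addrC.
  rewrite (_ : g t - _ = - (k^-1 * (f (t + k) - f t - g t * k))); last by field.
  by rewrite normrN normrM normfV mulrC ler_pdivrMr// normr_gt0.
have hr : `|h| < r by rewrite gtr0_norm// /h; lra.
have := quot h (lt0r_neq0 h0) hr.
have := quot (- h); rewrite oppr_eq0 normrN => /(_ (lt0r_neq0 h0) hr).
rewrite !(gtr0_norm h0) => qm qp.
near=> s.
have s0 : `|f (t + 0) - f (s + 0)| <= e * h / 4 by near: s; exact: near_shift.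
have sp : `|f (t + h) - f (s + h)| <= e * h / 4 by near: s; exact: near_shift.
have sm : `|f (t + - h) - f (s + - h)| <= e * h / 4 by near: s; exact: near_shift.
have := sub (s + h) s; have := sub (s - h) s.
rewrite (addrAC s (- h)) (addrAC s h) subrr !add0r => um up.
move: qm qp s0 sp sm; rewrite !addr0 !ler_norml.
move=> /andP[? ?] /andP[? ?] /andP[? ?] /andP[? ?] /andP[? ?].
apply/andP; split.
  rewrite -(ler_pM2r h0); lra.
rewrite -(ler_pM2r h0); lra.
Unshelve. all: by end_near. Qed.

End convex_derivative.

(** * Values and derivatives of the envelopes [psi] and [psieq] *)

Section barrier_envelopes.
Context {R : realType} (b : R -> \bar R) (Hb : barrier_assumptions b).
Implicit Types s t z : R.

Local Notation beta := (fine \o b).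
Local Notation beta' := ((fine \o b)^`()%classic).

(** The tangent of [b] at [u] has slope [rho], so [u] attains the supremum. *)
Lemma conjugateE (rho u : R) : u < 0 -> beta' u = rho ->
  conjugate b rho = (rho * u - beta u)%:E.
Proof.
move=> u0 urho; apply/eqP; rewrite eq_le; apply/andP; split; last first.
  by apply: ereal_sup_ubound; exists u => //; rewrite (barrier_fin Hb).
apply: ge_ereal_sup => _ [t _ <-]; have [t0|t0] := ltP t 0; last first.
  by rewrite (barrier_pinfty Hb t0) leNye.
rewrite (barrier_fin Hb t0) -EFinB lee_fin.
by have := barrier_tangent Hb t0 u0; rewrite urho; lra.
Qed.

Section inequality.
Variables (rho u : R).
Hypotheses (u0 : u < 0) (urho : beta' u = rho).

Lemma psi_le s z : 0 <= z -> s - z < 0 ->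
  (psi b rho s <= (rho * z + beta (s - z))%:E)%E.
Proof.
move=> z0 sz; apply: ereal_inf_lbound; exists z => //.
by rewrite (barrier_fin Hb sz).
Qed.

(** [t - w] is the minimizing [z] at [t]: zero if [t <= u], else the [z] with [beta' (t - z) = rho].
    The tangent at [w] bounds all competitors for all [s] at once, which gives the value of [psi]
    and a subgradient together. *)
Lemma psi_ge t s (w := Num.min t u) :
  ((rho * (t - w) + beta w + beta' w * (s - t))%:E <= psi b rho s)%E.
Proof.
have w0 : w < 0 by rewrite gt_min u0 orbT.
apply: le_ereal_inf_tmp => _ [z z0 <-].
have [sz|sz] := ltP (s - z) 0; last by rewrite (barrier_pinfty Hb sz) leey.
rewrite (barrier_fin Hb sz) -EFinD lee_fin.
have := barrier_tangent Hb sz w0.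
(* Complementarity at the minimizer: either [beta' w = rho], or [t - w = 0] and only [z >= 0]
   competes. *)
have : 0 <= (rho - beta' w) * (z - (t - w)).
  rewrite /w; have [tu|ut] := leP t u; last by rewrite urho subrr mul0r.
  by rewrite subrr subr0 mulr_ge0// subr_ge0 -urho (barrier_d1_le Hb).
by lra.
Qed.

Lemma psiE t (w := Num.min t u) :
  psi b rho t = (rho * (t - w) + beta w)%:E.
Proof.
apply/eqP; rewrite eq_le; apply/andP; split.
  have := @psi_le t (t - w); rewrite subKr => /=; apply; last by rewrite gt_min u0 orbT.
  by rewrite subr_ge0 ge_min lexx.
by have := psi_ge t t; rewrite /= subrr mulr0 addr0.
Qed.

Lemma psi_subgradient s t : fine (psi b rho t) + beta' (Num.min t u) * (s - t)
  <= fine (psi b rho s).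
Proof. by have := psi_ge t s; rewrite /= !psiE lee_fin. Qed.

Lemma is_derive_psi t :
  is_derive t 1 (fine \o psi b rho) (beta' (Num.min t u)).
Proof.
set w := Num.min t u; have w0 : w < 0 by rewrite gt_min u0 orbT.
pose v s := rho * (t - w) + beta (s - (t - w)).
have bw : is_derive w 1 beta (beta' w).
  by rewrite derive1E; apply/derivableP/(barrier_derivable Hb).
apply: (@is_derive_touching _ _ v).
- rewrite -[beta' w]add0r; apply: is_deriveD.
  by apply: is_derive_sub; rewrite subKr.
- by rewrite /= psiE/v subKr.
- by move=> s; exact: psi_subgradient.
(* As [w < 0], points [s] near [t] keep [s - (t - w)] in the domain of [b]. *)
- have : \forall s \near t, s < t - w by apply: lt_nbhsl; lra.
  apply: filterS => s sw; rewrite /v -lee_fin.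
  rewrite /= fineK; last by rewrite psiE.
  by apply: psi_le; rewrite ?subr_ge0 ?ge_min ?lexx//; lra.
Qed.

Lemma psi_derive1 t : (fine \o psi b rho)^`()%classic t = beta' (Num.min t u).
Proof. by rewrite derive1E; apply: derive_val; exact: is_derive_psi. Qed.

End inequality.

Section equality.
Variables (rho t0 : R).
(* Equivalent to [rho > 2 inf b']: the left-hand side of the optimality condition
   in [psieq_argmin] tends to [2 inf b'] as [z] tends to [+oo]. *)
Hypotheses (t00 : t0 < 0) (rhot0 : 2 * beta' t0 < rho).

(** The equation is the first-order condition in [z]. At the left end [|t| - u] of the interval one
    summand already equals [rho]; at the right end [|t| - t0] both are at most [beta' t0], so the
    sum is below [rho]. *)
Lemma psieq_argmin t : exists2 z, `|t| < z & beta' (t - z) + beta' (- t - z) = rho.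
Proof.
have t0_lt0 := t00; have rho_gt := rhot0.
have t0_gt0 := b_d1_gt0 Hb t00.
have [|u /andP[t0u u0] urho] := @barrier_d1_onto _ _ Hb t0 rho t00; first by lra.
have [a a_ge0 ta] : exists2 a : R, 0 <= a & `|t| = a by exists `|t|.
rewrite ta; pose f z := beta' (a - z) + beta' (- a - z).
(* Exchanging [t] and [- t] swaps the summands, so [|t|] may replace [t]. *)
have fE z : f z = beta' (t - z) + beta' (- t - z).
  by rewrite /f -ta; case: ger0P => _ //; rewrite opprK addrC.
have fc : {within `[a - u, a - t0], continuous f}.
  apply: continuous_in_subspaceT => z; rewrite inE/= in_itv/= => /andP[uz _].
  have bc r : r - z < 0 -> beta' (r - s) @[s --> z] --> beta' (r - z).
    move=> rz; have rs_cvg : r - s @[s --> z] --> r - z.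
      by apply: cvgB; [exact: cvg_cst|exact: cvg_id].
    exact: (cvg_comp _ _ rs_cvg (barrier_d1_continuous Hb rz)).
  by apply: cvgD; apply: bc; lra.
have [||z] := @IVT _ f (a - u) (a - t0) rho _ fc.
- by lra.
- have f1 : f (a - t0) <= rho.
    have : beta' (- a - (a - t0)) <= beta' t0 by apply: (barrier_d1_le Hb) => //; lra.
    by rewrite /f subKr; lra.
  have f2 : rho <= f (a - u).
    have : 0 < beta' (- a - (a - u)) by apply: (b_d1_gt0 Hb); lra.
    by rewrite /f subKr urho; lra.
  by rewrite ge_min f1 orbT/= le_max f2.
rewrite in_itv/= => /andP[uz _] fz; exists z; first by lra.
by rewrite -fE.
Qed.

Section argmin.
Variables (t z : R).
Hypotheses (tz : `|t| < z) (zrho : beta' (t - z) + beta' (- t - z) = rho).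

Let tz1 : t - z < 0. Proof. by rewrite subr_lt0 (le_lt_trans (ler_norm t)). Qed.

Let tz2 : - t - z < 0.
Proof. by rewrite subr_lt0 (le_lt_trans (ler_norm _)) ?normrN. Qed.

Lemma psieq_le s z' : s - z' < 0 -> - s - z' < 0 ->
  (psieq b rho s <= (rho * z' + beta (s - z') + beta (- s - z'))%:E)%E.
Proof.
move=> s1 s2; apply: ereal_inf_lbound; exists z' => //.
by rewrite (barrier_fin Hb s1) (barrier_fin Hb s2).
Qed.

(** When the tangents of [b] at [t - z] and [- t - z] are added, the dependence on the competitor
    [z'] cancels, because the two slopes sum to [rho]. *)
Lemma psieq_ge s :
  ((rho * z + beta (t - z) + beta (- t - z)
    + (beta' (t - z) - beta' (- t - z)) * (s - t))%:E <= psieq b rho s)%E.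
Proof.
apply: le_ereal_inf_tmp => _ [z' _ <-].
have [s1|s1] := ltP (s - z') 0; last first.
  rewrite (barrier_pinfty Hb s1) addey//; have [s2|s2] := ltP (- s - z') 0.
    by rewrite (barrier_fin Hb s2) addye// leey.
  by rewrite (barrier_pinfty Hb s2) leey.
have [s2|s2] := ltP (- s - z') 0; last first.
  by rewrite (barrier_fin Hb s1) (barrier_pinfty Hb s2) leey.
rewrite (barrier_fin Hb s1) (barrier_fin Hb s2) -!EFinD lee_fin.
have := barrier_tangent Hb s1 tz1; have := barrier_tangent Hb s2 tz2.
by rewrite -zrho; lra.
Qed.

Lemma psieqE : psieq b rho t = (rho * z + beta (t - z) + beta (- t - z))%:E.
Proof.
apply/eqP; rewrite eq_le psieq_le//=.
by have := psieq_ge t; rewrite subrr mulr0 addr0.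
Qed.

(** Two positive slopes with sum [rho] differ by at most [rho]. *)
Lemma psieq_derive1_bound : `|beta' (t - z) - beta' (- t - z)| <= rho.
Proof.
have := b_d1_gt0 Hb tz1; have := b_d1_gt0 Hb tz2; rewrite -zrho ler_norml.
by move=> ? ?; apply/andP; split; lra.
Qed.

End argmin.

Lemma psieq_fin t : psieq b rho t \is a fin_num.
Proof. by have [z tz zrho] := psieq_argmin t; rewrite (psieqE tz zrho). Qed.

Lemma is_derive_psieq_argmin t z : `|t| < z ->
  beta' (t - z) + beta' (- t - z) = rho ->
  is_derive t 1 (fine \o psieq b rho) (beta' (t - z) - beta' (- t - z)).
Proof.
move=> tz zrho.
have tz1 : t - z < 0 by rewrite subr_lt0 (le_lt_trans (ler_norm t)).
have tz2 : - t - z < 0 by rewrite subr_lt0 (le_lt_trans (ler_norm _)) ?normrN.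
pose v s := rho * z + beta (s - z) + beta (- s - z).
apply: (@is_derive_touching _ _ v).
- apply: is_deriveD.
    rewrite -[beta' _]add0r; apply: is_deriveD; apply: is_derive_sub.
    by rewrite derive1E; apply/derivableP/(barrier_derivable Hb).
  apply: is_derive_opp_sub.
  by rewrite derive1E; apply/derivableP/(barrier_derivable Hb).
- by rewrite /= (psieqE tz zrho).
- move=> s; rewrite -lee_fin /= EFinD fineK ?psieq_fin// fineK ?psieq_fin//.
  by rewrite (psieqE tz zrho) -EFinD; exact: psieq_ge.
- have sz1 : \forall s \near t, s < z by apply: lt_nbhsl; lra.
  have sz2 : \forall s \near t, - z < s by apply: lt_nbhsr; lra.
  near=> s; rewrite /v -lee_fin /= fineK ?psieq_fin//; apply: psieq_le.
    by rewrite subr_lt0; near: s.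
  by rewrite subr_lt0 ltrNl; near: s.
Unshelve. all: by end_near. Qed.

(** This form frees later uses from the choice of a minimizer. *)
Lemma is_derive_psieq t :
  is_derive t 1 (fine \o psieq b rho) ((fine \o psieq b rho)^`()%classic t).
Proof.
have [z tz zrho] := psieq_argmin t.
rewrite derive1E; apply/derivableP.
exact: (@ex_derive _ _ _ _ _ _ _ (is_derive_psieq_argmin tz zrho)).
Qed.

Lemma psieq_derive1_argmin t z : `|t| < z ->
  beta' (t - z) + beta' (- t - z) = rho ->
  (fine \o psieq b rho)^`()%classic t = beta' (t - z) - beta' (- t - z).
Proof.
move=> tz zrho; rewrite derive1E; apply: derive_val.
exact: is_derive_psieq_argmin.
Qed.

Lemma psieq_derive1_le t : `|(fine \o psieq b rho)^`()%classic t| <= rho.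
Proof.
have [z tz zrho] := psieq_argmin t.
by rewrite (psieq_derive1_argmin tz zrho); exact: psieq_derive1_bound.
Qed.

(** Convexity yields continuity without studying how the minimizer varies with [t]. *)
Lemma psieq_derive1_continuous : continuous (fine \o psieq b rho)^`()%classic.
Proof.
apply: (@convex_derive_continuous _ (fine \o psieq b rho)) => [|s t].
  exact: is_derive_psieq.
have [z tz zrho] := psieq_argmin t.
rewrite -lee_fin /= EFinD fineK ?psieq_fin// fineK ?psieq_fin//.
rewrite (psieqE tz zrho) (psieq_derive1_argmin tz zrho) -EFinD.
exact: psieq_ge.
Qed.

End equality.

End barrier_envelopes.

(** * Smooth perturbations of the limiting subdifferential *)

Section matrix_convergence.
Context {R : realType}.

Lemma cvg_mx_entries {T : Type} {F : set_system T} {FF : Filter F} m n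
    (f : T -> 'M[R]_(m, n)) (M : 'M[R]_(m, n)) :
  (forall i j, f t i j @[t --> F] --> M i j) -> f @ F --> M.
Proof.
move=> fM; apply/cvg_ballP => e e0.
have : \forall t \near F, forall i j, ball (M i j) e (f t i j).
  apply: filter_forall => i; apply: filter_forall => j.
  by move/cvg_ballP : (fM i j); exact.
by apply: filterS => t Mft; split.
Qed.

Lemma cvg_entry {T : Type} {F : set_system T} {FF : Filter F} m n
    (f : T -> 'M[R]_(m, n)) (M : 'M[R]_(m, n)) i j :
  f @ F --> M -> f t i j @[t --> F] --> M i j.
Proof. by move=> fM; exact: (cvg_comp _ _ fM (@coord_continuous _ _ _ i j M)). Qed.

Lemma cvg_mulmx {T : Type} {F : set_system T} {FF : Filter F} m n p
    (f : T -> 'M[R]_(m, n)) (g : T -> 'M[R]_(n, p))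
    (M : 'M[R]_(m, n)) (N : 'M[R]_(n, p)) :
  f @ F --> M -> g @ F --> N -> f t *m g t @[t --> F] --> M *m N.
Proof.
move=> fM gN; apply: cvg_mx_entries => i j.
under eq_fun do rewrite mxE; rewrite mxE.
apply: cvg_big => [|k _]; first exact: add_continuous.
by apply: cvgM; exact: cvg_entry.
Qed.

Lemma cvg_trmx {T : Type} {F : set_system T} {FF : Filter F} m n
    (f : T -> 'M[R]_(m, n)) (M : 'M[R]_(m, n)) :
  f @ F --> M -> (f t)^T @[t --> F] --> M^T.
Proof.
move=> fM; apply: cvg_mx_entries => i j.
by under eq_fun do rewrite mxE; rewrite mxE; exact: cvg_entry.
Qed.

End matrix_convergence.

Section euclidean_norm.
Context {R : realType} {n : nat}.
Implicit Types x y g : 'rV[R]_n.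

Lemma innerDl g1 g2 x : inner (g1 + g2) x = inner g1 x + inner g2 x.
Proof. by rewrite -big_split; apply: eq_bigr => i _; rewrite mxE mulrDl. Qed.

Lemma innerZl (a : R) g x : inner (a *: g) x = a * inner g x.
Proof. by rewrite /inner mulr_sumr; apply: eq_bigr => i _; rewrite mxE mulrA. Qed.

Lemma innerNl g x : inner (- g) x = - inner g x.
Proof. by rewrite -scaleN1r innerZl mulN1r. Qed.

Lemma inner0l x : inner 0 x = 0.
Proof. by rewrite -(scale0r 0) innerZl mul0r. Qed.

Lemma enorm_ge0 x : 0 <= enorm x.
Proof. exact: sqrtr_ge0. Qed.

Lemma enorm0 : enorm (0 : 'rV[R]_n) = 0.
Proof. by rewrite /enorm inner0l sqrtr0. Qed.

Lemma norm_le_enorm x : `|x| <= enorm x.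
Proof.
rewrite /Num.Def.normr/= mx_normrE; apply/bigmax_leP; split => [|[i j] _ /=].
  exact: enorm_ge0.
rewrite ord1 -sqrtr_sqr ler_wsqrtr// /inner (bigD1 j)//= -expr2 lerDl.
by apply: sumr_ge0 => k _; rewrite -expr2 sqr_ge0.
Qed.

Lemma enorm_gt0 x : x != 0 -> 0 < enorm x.
Proof. by move=> x0; rewrite (lt_le_trans _ (norm_le_enorm x))// normr_gt0. Qed.

Lemma cvg_enorm0 {T : Type} {F : set_system T} {FF : Filter F} (f : T -> 'rV[R]_n) :
  f @ F --> (0 : 'rV[R]_n) -> enorm (f t) @[t --> F] --> (0 : R).
Proof.
move=> f0; rewrite -enorm0.
have ff0 : inner (f t) (f t) @[t --> F] --> inner (0 : 'rV[R]_n) 0.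
  apply: cvg_big => [|k _]; first exact: add_continuous.
  by apply: cvgM; exact: cvg_entry.
exact: (cvg_comp _ _ ff0 (@sqrt_continuous R _)).
Qed.

End euclidean_norm.

Section gradient.
Context {R : realType} {n : nat}.
Implicit Types (phi : 'rV[R]_n -> R) (x g : 'rV[R]_n).

Definition has_gradient phi x g :=
  differentiable phi x /\ forall h, 'd phi x h = inner g h.

(** The remainder is small relative to the sup norm, which [enorm] dominates. *)
Lemma has_gradient_near phi x g : has_gradient phi x g ->
  forall e, 0 < e -> \forall z \near x,
    `|phi z - phi x - inner g (z - x)| <= e * enorm (z - x).
Proof.
move=> [/diff_locallyP[_ /eqaddoP phiE] dphi] e e0.
rewrite (near_shift 0); apply: filterS (phiE _ e0) => z /=.
rewrite subr0 addrK -dphi opprD addrA => /le_trans; apply.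
by rewrite ler_pM2l// norm_le_enorm.
Qed.

Lemma has_gradientD phi1 phi2 x g1 g2 : has_gradient phi1 x g1 ->
  has_gradient phi2 x g2 -> has_gradient (phi1 \+ phi2) x (g1 + g2).
Proof.
move=> [d1 E1] [d2 E2]; split; first exact: differentiableD.
by move=> h; rewrite (diffD d1 d2) /= E1 E2 innerDl.
Qed.

Lemma has_gradient_sum (I : Type) (r : seq I) (phi : I -> 'rV[R]_n -> R) x
    (g : I -> 'rV[R]_n) : (forall i, has_gradient (phi i) x (g i)) ->
  has_gradient (fun z => \sum_(i <- r) phi i z) x (\sum_(i <- r) g i).
Proof.
move=> phig; elim: r => [|i r IH].
  rewrite big_nil; under eq_fun do rewrite big_nil.
  by split => [|h]; [exact: differentiable_cst|rewrite diff_cst inner0l].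
rewrite big_cons; under eq_fun do rewrite big_cons.
exact: has_gradientD.
Qed.

Lemma has_gradient_comp (f : R -> R) phi x g (d : R) :
  is_derive (phi x) 1 f d -> has_gradient phi x g ->
  has_gradient (f \o phi) x (d *: g).
Proof.
move=> fd [dphi E]; have df : differentiable f (phi x).
  by apply/derivable1_diffP; exact: (@ex_derive _ _ _ _ _ _ _ fd).
split => [|h]; first exact: differentiable_comp.
by rewrite diff_comp//= E diff1E// derive1E derive_val innerZl mulrC.
Qed.

Lemma has_gradient_coord m (c : 'rV[R]_n -> 'rV[R]_m) x i : differentiable c x ->
  has_gradient (fun z => c z ord0 i) x (row i ('J c x)^T).
Proof.
move=> dc; have dcoord := @differentiable_coord R 1 m (c x) ord0 i.
split; first exact: (@differentiable_comp _ _ _ _ c (fun N : 'rV[R]_m => N ord0 i)).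
move=> h; rewrite -deriveE; last first.
  exact: (@differentiable_comp _ _ _ _ c (fun N : 'rV[R]_m => N ord0 i)).
have := derive_mx (@diff_derivable _ _ _ _ _ h dc); rewrite deriveEjacobian//.
move=> /matrixP/(_ ord0 i); rewrite !mxE => <-.
by apply: eq_bigr => k _; rewrite !mxE mulrC.
Qed.

End gradient.

Section subdifferentials.
Context {R : realType} {n : nat}.
Implicit Types (q f : 'rV[R]_n -> \bar R) (phi : 'rV[R]_n -> R).
Implicit Types x v g z : 'rV[R]_n.

(** Multiplying the quotient by [enorm (z - x)] removes the division; at [z = x], outside the
    deleted neighbourhood, the inequality is trivial. *)
Lemma regular_subdifferentialP f x v : f x \is a fin_num ->
  regular_subdifferential f x v <->
  forall e, 0 < e -> \forall z \near x,
    ((fine (f x) + inner v (z - x) - e * enorm (z - x))%:E <= f z)%E.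
Proof.
move=> fx; rewrite /regular_subdifferential/= limf_einfE; split.
- move=> [_ fv] e e0.
  have : ((- e)%:E < ereal_sup [set ereal_inf
    ((fun z => (f z - f x - (inner v (z - x))%:E) * ((enorm (z - x))^-1)%:E)%E @` V)
    | V in x^'])%E by rewrite (lt_le_trans _ fv)// lte_fin oppr_lt0.
  move=> /ereal_sup_gt[_ [V xV <-] eV].
  have {}xV : \forall z \near x, z != x -> V z by exact: xV.
  apply: filterS xV => z Vz; have [->|zx] := eqVneq z x.
    rewrite subrr enorm0 mulr0 subr0 /inner big1 ?addr0 ?fineK// => i _.
    by rewrite mxE mulr0.
  have en : 0 < enorm (z - x) by rewrite enorm_gt0// subr_eq0.
  have {eV} : ((- e)%:E <=
      (f z - f x - (inner v (z - x))%:E) * ((enorm (z - x))^-1)%:E)%E.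
    by apply/ltW/(lt_le_trans eV)/ereal_inf_lbound; exists z => //; exact: Vz.
  rewrite -{1}(fineK fx).
  case: (f z) => [r|_|]; [|by rewrite leey|].
    rewrite -!EFinB -EFinM !lee_fin ler_pdivlMr//; lra.
  (* [f z = -oo] would make the quotient [-oo], below [- e]. *)
  by rewrite /= mulNyr gtr0_sg ?invr_gt0// mul1e leeNy_eq.
- move=> fv; split => //; apply/lee_subgt0Pr => e e0; rewrite sub0e.
  pose V := [set z | z != x /\
    ((fine (f x) + inner v (z - x) - e * enorm (z - x))%:E <= f z)%E].
  apply: le_trans (ereal_sup_ubound _); last first.
    by exists V => //; apply: filterS (fv _ e0) => z fz zx; split.
  apply: le_ereal_inf_tmp => _ [z [zx fz] <-].
  have en : 0 < enorm (z - x) by rewrite enorm_gt0// subr_eq0.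
  move: fz; rewrite -{2}(fineK fx).
  case: (f z) => [r|_|]; [|by rewrite mulyr gtr0_sg ?invr_gt0// mul1e leey|by []].
  by rewrite -!EFinB -EFinM !lee_fin ler_pdivlMr//; lra.
Qed.

Lemma fin_num_addEFin q phi z :
  (q z + (phi z)%:E)%E \is a fin_num = (q z \is a fin_num).
Proof. by rewrite fin_numD andbT. Qed.

Lemma regular_subdifferentialB q phi x v g : has_gradient phi x g ->
  regular_subdifferential (fun z => q z + (phi z)%:E)%E x v ->
  regular_subdifferential q x (v - g).
Proof.
move=> phig vq; have qphi := proj1 vq.
have qx : q x \is a fin_num by rewrite -(fin_num_addEFin q phi).
move/(regular_subdifferentialP _ qphi) : vq => vq.
apply/regular_subdifferentialP => // e e0; have e20 : 0 < e / 2 by rewrite divr_gt0.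
near=> z.
have vz : ((fine (q x + (phi x)%:E) + inner v (z - x)
    - e / 2 * enorm (z - x))%:E <= q z + (phi z)%:E)%E by near: z; exact: vq.
have gz : `|phi z - phi x - inner g (z - x)| <= e / 2 * enorm (z - x).
  by near: z; exact: has_gradient_near.
move: vz gz; rewrite fineD//= innerDl innerNl ler_norml.
case: (q z) => [r|_|//]; last by rewrite leey.
by rewrite -EFinD !lee_fin => vz /andP[? ?]; lra.
Unshelve. all: by end_near. Qed.

(** The approximating points are kept and their regular subgradients shifted by [- grad (z j)];
    continuity of [grad] carries the shift to the limit. *)
Lemma subdifferentialB q phi (grad : 'rV[R]_n -> 'rV[R]_n) x v :
  (forall z, has_gradient phi z (grad z)) -> continuous grad ->
  subdifferential (fun z => q z + (phi z)%:E)%E x v ->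
  subdifferential q x (v - grad x).
Proof.
move=> phig gradc [qphi [z [w [zx fz zw wv]]]].
have qx : q x \is a fin_num by rewrite -(fin_num_addEFin q phi).
split => //; exists z, (fun j => w j - grad (z j)); split => //.
- have phiz : (fun j => (phi (z j))%:E) @ \oo --> (phi x)%:E.
    apply: cvg_EFin; first exact: nearW.
    have phic : {for x, continuous phi}.
      by apply: differentiable_continuous; have [] := phig x.
    exact: (cvg_comp _ _ zx phic).
  (* Subtracting the finite, convergent values of [phi] recovers the convergence of the values of
     [q]. *)
  have : (fun j => q (z j) + (phi (z j))%:E - (phi (z j))%:E)%E @ \oo -->
      (q x + (phi x)%:E - (phi x)%:E)%E.
    by apply: cvgeB => //; rewrite fin_num_adde_defl.
  by rewrite addeK//; under eq_fun do rewrite addeK//.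
- by move=> j; apply: regular_subdifferentialB (zw j); exact: phig.
- by apply: cvgB => //; exact: (cvg_comp _ _ zx (gradc x)).
Qed.

End subdifferentials.

(** * The penalty-barrier function *)

Section separable_composition.
Context {R : realType} {n m : nat}.
Variables (c : 'rV[R]_n -> 'rV[R]_m) (f : R -> R) (a : R).

Lemma has_gradient_separable x : differentiable c x ->
  (forall t : R, is_derive t 1 f (f^`()%classic t)) ->
  has_gradient (fun z => a * \sum_(i < m) f (c z ord0 i)) x
    (jacT c x (\row_i (a * f^`()%classic (c x ord0 i)))).
Proof.
move=> dc df; rewrite /jacT mulmx_sum_row.
under eq_fun do rewrite mulr_sumr.
apply: has_gradient_sum => i; rewrite mxE.
apply: (@has_gradient_comp _ _ (fun t => a * f t) (fun z => c z ord0 i)).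
exact: has_gradient_coord.
Qed.

Lemma continuous_gradient_separable : continuously_differentiable c ->
  continuous f^`()%classic ->
  continuous (fun x => jacT c x (\row_i (a * f^`()%classic (c x ord0 i)))).
Proof.
move=> [dc cJ] cf x.
apply: (@cvg_mulmx _ _ (nbhs x) _ _ _ _
  (fun z => \row_i (a * f^`()%classic (c z ord0 i)))
  (fun z => ('J c z)^T)); last exact: (@cvg_trmx _ _ (nbhs x) _ _ _ _ _ (cJ x)).
apply: cvg_mx_entries => j i; under eq_fun do rewrite mxE; rewrite mxE.
apply: cvgM; first exact: cvg_cst.
have cx : c z ord0 i @[z --> x] --> c x ord0 i.
  exact: (@cvg_entry _ _ (nbhs x) _ _ _ _ _ _ _ (differentiable_continuous (dc x))).
exact: (cvg_comp _ _ cx (cf _)).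
Qed.

End separable_composition.

Section penalty_barrier_function.
Context {R : realType} {n m meq : nat}.
Variables (q : 'rV[R]_n -> \bar R).
Variables (c : 'rV[R]_n -> 'rV[R]_m) (ceq : 'rV[R]_n -> 'rV[R]_meq).
Variable b : R -> \bar R.
Hypotheses (cC1 : continuously_differentiable c).
Hypotheses (ceqC1 : continuously_differentiable ceq).
Hypothesis Hb : barrier_assumptions b.

Local Notation beta := (fine \o b).
Local Notation beta' := ((fine \o b)^`()%classic).

Variables (alpha mu : R).
Hypothesis mu_gt0 : 0 < mu.
(* [-1] is an arbitrary point of [dom b]; any bound that makes the minima in [psi]
   and [psieq] attained would do, as [alpha / mu] tends to [+oo]. *)
Hypothesis rho_large : 2 * beta' (-1) < alpha / mu.

Let ltN10 : -1 < 0 :> R. Proof. by rewrite ltrN10. Qed.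

Let rho_attained : exists2 u, u < 0 & beta' u = alpha / mu.
Proof.
have d1 := b_d1_gt0 Hb ltN10; have rho_gt := rho_large.
have [|u /andP[_ u0] urho] := @barrier_d1_onto _ _ Hb (-1) (alpha / mu) ltN10.
  lra.
by exists u.
Qed.

(** The multipliers are [mu] times the derivatives of the envelopes, so the vector subtracted is
    exactly the gradient of the smooth part. *)
Lemma subdifferential_penalty_barrier x v :
  subdifferential (penalty_barrier q c ceq b alpha mu) x v ->
  subdifferential q x (v - (jacT c x (multiplier c b alpha mu x)
                          + jacT ceq x (multipliereq ceq b alpha mu x))).
Proof.
have [u u0 urho] := rho_attained.
have dpsi (t : R) : is_derive t 1 (fine \o psi b (alpha / mu))
    ((fine \o psi b (alpha / mu))^`()%classic t).
  by rewrite (psi_derive1 Hb u0 urho); exact: is_derive_psi.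
have cpsi : continuous (fine \o psi b (alpha / mu))^`()%classic.
  apply: (convex_derive_continuous dpsi) => s t.
  by rewrite (psi_derive1 Hb u0 urho); exact: psi_subgradient.
pose phi z := mu * (\sum_(i < m) (fine \o psi b (alpha / mu)) (c z ord0 i))
  + mu * (\sum_(j < meq) (fine \o psieq b (alpha / mu)) (ceq z ord0 j)).
have -> : penalty_barrier q c ceq b alpha mu = (fun z => q z + (phi z)%:E)%E.
  apply/funext => z; rewrite /penalty_barrier /phi EFinD !EFinM -!sumEFin addeA.
  congr (_ + _ * _ + _ * _)%E; apply: eq_bigr => i _; rewrite /= fineK//.
    by rewrite (psiE Hb u0 urho).
  exact: (psieq_fin Hb ltN10 rho_large).
apply: (@subdifferentialB _ _ q phi (fun z => jacT c z (multiplier c b alpha mu z)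
                          + jacT ceq z (multipliereq ceq b alpha mu z))).
- move=> z; apply: has_gradientD.
    exact: (has_gradient_separable _ (proj1 cC1 z)).
  apply: (has_gradient_separable _ (proj1 ceqC1 z)).
  exact: (is_derive_psieq Hb ltN10 rho_large).
- have cpsieq := psieq_derive1_continuous Hb ltN10 rho_large.
  have g1 : continuous (fun z => jacT c z (multiplier c b alpha mu z)).
    exact: continuous_gradient_separable.
  have g2 : continuous (fun z => jacT ceq z (multipliereq ceq b alpha mu z)).
    exact: continuous_gradient_separable.
  by move=> z; exact: (cvgD (g1 z) (g2 z)).
Qed.

Lemma multiplier_gt0 x i : 0 < multiplier c b alpha mu x ord0 i.
Proof.
have [u u0 urho] := rho_attained.
rewrite mxE (psi_derive1 Hb u0 urho) mulr_gt0//.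
by apply: (b_d1_gt0 Hb); rewrite gt_min u0 orbT.
Qed.

Lemma multiplier_le x i : multiplier c b alpha mu x ord0 i <= alpha.
Proof.
have [u u0 urho] := rho_attained.
rewrite mxE (psi_derive1 Hb u0 urho) mulrC -ler_pdivlMr// -urho.
by apply: (barrier_d1_le Hb) => //; rewrite ge_min lexx orbT.
Qed.

(** Unlike the bound [alpha], this one tends to [0] with [mu] as long as the constraint stays below
    a fixed negative [t]. *)
Lemma multiplier_le_barrier x i (t : R) : c x ord0 i <= t -> t < 0 ->
  multiplier c b alpha mu x ord0 i <= mu * beta' t.
Proof.
have [u u0 urho] := rho_attained => ct t0.
rewrite mxE (psi_derive1 Hb u0 urho) ler_pM2l//.
by apply: (barrier_d1_le Hb) => //; rewrite ge_min ct.
Qed.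

Lemma multipliereq_le x j : `|multipliereq ceq b alpha mu x ord0 j| <= alpha.
Proof.
rewrite mxE normrM gtr0_norm// mulrC -ler_pdivlMr//.
exact: (psieq_derive1_le Hb ltN10 rho_large).
Qed.

End penalty_barrier_function.

(** * Limit and monotonicity of the scaled conjugate *)

Section scaled_conjugate_limit.
Context {R : realType} (b : R -> \bar R) (Hb : barrier_assumptions b).

Local Notation beta := (fine \o b).
Local Notation beta' := ((fine \o b)^`()%classic).

Lemma scaled_conjugateE (alpha mu u : R) : 0 < alpha -> 0 < mu -> u < 0 ->
  beta' u = alpha / mu ->
  scaled_conjugate b alpha mu = (beta u / (alpha / mu) - u)%:E.
Proof.
move=> a0 m0 u0 urho; rewrite /scaled_conjugate (conjugateE Hb u0 urho) -EFinM.
by congr EFin; field; rewrite !gt_eqF.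
Qed.

(** Positivity of [beta u] serves twice: it keeps the scaled conjugate above [0], and it makes
    [beta u / rho] strictly decreasing in [rho]. *)
Lemma barrier_d1_large : exists M : R, forall rho, M < rho ->
  exists u, [/\ u < 0, beta' u = rho & 0 < beta u].
Proof.
have [t t0 bt] := barrier_blowup Hb 0.
exists (beta' t) => rho rhoM.
have [u /andP[tu u0] urho] := barrier_d1_onto Hb t0 rhoM.
by exists u; split=> //; apply: bt => //; exact: ltW.
Qed.

(** The tangent inequality at [u], divided by [rho]; every [t < 0] thus serves as a test point for
    an upper bound. *)
Lemma conjugate_value_le (u t rho : R) : 0 < rho -> u < 0 -> t < 0 ->
  beta' u = rho -> beta u / rho - u <= beta t / rho - t.
Proof.
move=> rho0 u0 t0 urho; have := barrier_tangent Hb t0 u0.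
rewrite urho => ut.
have : beta u / rho <= (beta t - rho * (t - u)) / rho.
  by rewrite ler_pM2r ?invr_gt0//; lra.
by rewrite mulrBl mulrAC divff ?gt_eqF// mul1r; lra.
Qed.

Variables alpha mu : nat -> R.
Hypotheses (alpha_gt0 : forall k, 0 < alpha k) (mu_gt0 : forall k, 0 < mu k).
Hypothesis rho_large : forall M, \forall k \near \oo, M < alpha k / mu k.

Lemma scaled_conjugate_cvg0 :
  (fun k => scaled_conjugate b (alpha k) (mu k)) @ \oo --> 0%E.
Proof.
have [M HM] := barrier_d1_large.
have rho0 k : 0 < alpha k / mu k by rewrite divr_gt0.
apply/fine_cvgP; split.
  apply: filterS (rho_large M) => k /HM[u [u0 urho _]].
  by rewrite (scaled_conjugateE _ _ u0 urho).
apply/cvgr0Pnorm_le => e e0.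
(* This test point contributes [e / 2] through [- t]; the other half bounds [beta t / rho] once
   [rho] is large. *)
have t0 : - (e / 2) < 0 by rewrite oppr_lt0 divr_gt0.
near=> k.
have [|u [u0 urho bu]] := HM (alpha k / mu k); first by near: k; exact: rho_large.
have ut := conjugate_value_le (rho0 k) u0 t0 urho.
rewrite /= (scaled_conjugateE _ _ u0 urho)//=.
have bt : beta (- (e / 2)) / (alpha k / mu k) <= e / 2.
  rewrite ler_pdivrMr// [leRHS]mulrC -ler_pdivrMr ?divr_gt0// ltW//.
  by near: k; exact: rho_large.
have bu0 : 0 < beta u / (alpha k / mu k) by rewrite divr_gt0.
by move: ut bt bu0 => /= ut bt bu0; rewrite ger0_norm; lra.
Unshelve. all: by end_near. Qed.

(** The old minimizer [u] is a test point at the new ratio, and [beta u > 0] makes its value there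
    strictly smaller than the old one. *)
Lemma scaled_conjugate_decreasing :
  (forall k, alpha k / mu k < alpha k.+1 / mu k.+1) ->
  \forall k \near \oo, (scaled_conjugate b (alpha k.+1) (mu k.+1)
    < scaled_conjugate b (alpha k) (mu k))%E.
Proof.
move=> rho_incr; have [M HM] := barrier_d1_large.
have rho0 k : 0 < alpha k / mu k by rewrite divr_gt0.
apply: filterS (rho_large M) => k Mk.
have [u [u0 urho bu]] := HM _ Mk.
have [v [v0 vrho _]] := HM _ (lt_trans Mk (rho_incr k)).
rewrite (scaled_conjugateE _ _ u0 urho)// (scaled_conjugateE _ _ v0 vrho)//.
rewrite lte_fin (le_lt_trans (conjugate_value_le _ v0 u0 vrho))//.
by rewrite ltrD2r ltr_pM2l// ltf_pV2 ?posrE//.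
Qed.

End scaled_conjugate_limit.

(** * The iterates *)

Section real_sequences.
Context {R : realType}.
Implicit Types u : nat -> R.

Lemma geometric_growth_cvgy u (r : R) : 1 < r -> 0 < u 0%N ->
  (forall k, r * u k <= u k.+1) -> forall M, \forall k \near \oo, M < u k.
Proof.
move=> r1 u0 ur M.
have d0 : 0 < (r - 1) * u 0%N by rewrite mulr_gt0// subr_gt0.
(* Bernoulli's inequality: a linear lower bound is enough for divergence. *)
have uk k : u 0%N + ((r - 1) * u 0%N) *+ k <= u k.
  elim: k => [|k IH]; first by rewrite mulr0n addr0.
  have ku : u 0%N <= u k by rewrite (le_trans _ IH)// lerDl mulrn_wge0// ltW.
  have : (r - 1) * u 0%N <= (r - 1) * u k by rewrite ler_pM2l// subr_gt0.
  by have := ur k; rewrite mulrS; lra.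
have [N MN] : exists N : nat, `|M| / ((r - 1) * u 0%N) < N%:R.
  by eexists; apply: archi_boundP; rewrite divr_ge0// ltW.
exists N => // k /= Nk; apply: le_lt_trans (ler_norm M) _.
apply: lt_le_trans (uk k); rewrite -mulr_natr.
move: MN; rewrite ltr_pdivrMr// mulrC => /lt_le_trans; apply.
rewrite -[leLHS]add0r lerD//; first exact: ltW.
by rewrite ler_pM2l// ler_nat.
Qed.

(** Infinitely many reductions push [u] below every [r ^+ j * u 0], and [u] never increases in
    between. *)
Lemma cvg0_or_stationary u (r : R) (reduce : pred nat) :
  0 < r < 1 -> (forall k, 0 < u k) ->
  (forall k, u k.+1 = if reduce k then r * u k else u k) ->
  u @ \oo --> (0 : R) \/ \forall k \near \oo, ~~ reduce k.
Proof.
move=> /andP[r0 r1] u0 uS.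
have [stat|nstat] := pselect (\forall k \near \oo, ~~ reduce k); first by right.
left; have redN N : exists2 k, (N <= k)%N & reduce k.
  have [//|Nred] := pselect (exists2 k, (N <= k)%N & reduce k).
  case: nstat; exists N => // k /= Nk.
  by apply/negP => kred; apply: Nred; exists k.
have udecr k l : (k <= l)%N -> u l <= u k.
  move=> /subnK <-; elim: (l - k)%N => // i IH; rewrite addSn uS.
  case: ifP => // _; apply: le_trans IH; rewrite ler_piMl// ltW//.
have ugeom j : exists N, u N <= r ^+ j * u 0%N.
  elim: j => [|j [N IH]]; first by exists 0%N; rewrite expr0 mul1r.
  have [k Nk kred] := redN N; exists k.+1.
  rewrite uS kred exprS -mulrA ler_pM2l//.
  exact: le_trans (udecr _ _ Nk) IH.
have rj : r ^+ j * u 0%N @[j --> \oo] --> (0 : R).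
  rewrite -[X in _ --> X](mul0r (u 0%N)); apply: cvgM; last exact: cvg_cst.
  by apply: cvg_expr; rewrite ger0_norm// ltW.
apply/cvgr0Pnorm_le => e e0.
have [J _ Je] := (cvgr0Pnorm_le _).1 rj e e0.
have [N uN] := ugeom J; exists N => // k /= Nk.
rewrite gtr0_norm// (le_trans (udecr _ _ Nk))// (le_trans uN)//.
exact: le_trans (ler_norm _) (Je J (leqnn J)).
Qed.

(** [phi] is chosen with [k <= phi k], which gives [phi @ \oo --> \oo] although [phi] need not be
    increasing. *)
Lemma cluster_subsequence n (x : nat -> 'rV[R]_n) xbar : cluster (x @ \oo) xbar ->
  exists2 phi : nat -> nat, phi @ \oo --> \oo & x \o phi @ \oo --> xbar.
Proof.
move=> xcl.
have /choice[phi phiP] k : exists l, (k <= l)%N /\ ball xbar (k.+1%:R^-1) (x l).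
  have [||y [[l kl <-]]] := xcl (x @` [set l | (k <= l)%N]) (ball xbar (k.+1%:R^-1)).
  - by exists k => // l /= kl; exists l.
  - by apply: nbhsx_ballx; rewrite invr_gt0.
  by exists l.
exists phi.
  move=> A [N _ NA]; exists N => // k /= Nk; apply: NA => /=.
  exact: leq_trans Nk (phiP k).1.
apply/cvg_ballP => e e0.
have := @cvg_harmonic R; move=> /cvgr0Pnorm_lt/(_ e e0).
apply: filterS => k; rewrite /harmonic ger0_norm ?invr_ge0// => /ltW ke.
exact: le_ball ke _ (phiP k).2.
Qed.

End real_sequences.

Section iterates.
Context {R : realType} {n m meq : nat}.
Variables (q : 'rV[R]_n -> \bar R).
Variables (c : 'rV[R]_n -> 'rV[R]_m) (ceq : 'rV[R]_n -> 'rV[R]_meq).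
Variables (b : R -> \bar R) (P : alg_params (R := R)).
Variables (x : nat -> 'rV[R]_n) (y : nat -> 'rV[R]_m) (yeq : nat -> 'rV[R]_meq).
Variables (alpha mu eps p s : nat -> R).
Hypothesis HP : alg_params_assumptions P.
Hypothesis run : runs_indefinitely q c ceq b P x y yeq alpha mu eps p s.

Lemma run_alpha_gt0 k : 0 < alpha k.
Proof.
elim: k => [|k IH]; first by rewrite (run_alpha0 run) (alpha0_gt0 HP).
rewrite (run_alpha run); case: ifP => // _; rewrite mulr_gt0//.
exact: lt_trans ltr01 (delta_alpha_gt1 HP).
Qed.

Lemma run_mu_gt0 k : 0 < mu k.
Proof.
elim: k => [|k IH]; first by rewrite (run_mu0 run) (mu0_gt0 HP).
rewrite (run_mu run); case: ifP => // _; rewrite mulr_gt0//.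
by have /andP[] := delta_mu_in01 HP.
Qed.

Lemma run_rho_growth : exists2 r, 1 < r &
  forall k, r * (alpha k / mu k) <= alpha k.+1 / mu k.+1.
Proof.
have /andP[d0 d1] := delta_mu_in01 HP; have a1 := delta_alpha_gt1 HP.
exists (Num.min (delta_alpha P) (delta_mu P)^-1).
  by rewrite lt_min a1 invf_gt1.
move=> k; have ak := run_alpha_gt0 k; have mk := run_mu_gt0 k.
have rk : 0 < alpha k / mu k by rewrite divr_gt0.
(* An unchanged [alpha] forces the reduction of [mu]; otherwise [alpha] gains its factor and [mu]
   does not grow. *)
have [akS|akS] := eqVneq (alpha k.+1) (alpha k).
  rewrite (run_mu run) akS eqxx orbT invfM [leRHS]mulrCA ler_pM2r//.
  by rewrite ge_min lexx orbT.
have aS : alpha k.+1 = delta_alpha P * alpha k.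
  by move: akS; rewrite (run_alpha run); case: ifP => // _; rewrite eqxx.
have mS : mu k.+1 <= mu k.
  by rewrite (run_mu run); case: ifP => // _; rewrite ler_piMl// ltW.
rewrite aS -mulrA; apply: ler_pM => //.
- by rewrite le_min !ltW ?invr_gt0// (lt_trans ltr01).
- exact: ltW.
- by rewrite ge_min lexx.
- by rewrite ler_pM2l// lef_pV2 ?posrE ?run_mu_gt0.
Qed.

Lemma run_rho_cvgy M : \forall k \near \oo, M < alpha k / mu k.
Proof.
have [r r1 rk] := run_rho_growth.
apply: (@geometric_growth_cvgy _ (fun k => alpha k / mu k) r r1) => //.
by rewrite divr_gt0 ?run_alpha_gt0 ?run_mu_gt0.
Qed.

Lemma run_rho_increasing k : alpha k / mu k < alpha k.+1 / mu k.+1.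
Proof.
have [r r1 rk] := run_rho_growth; apply: lt_le_trans (rk k).
by rewrite ltr_pMl// divr_gt0 ?run_alpha_gt0 ?run_mu_gt0.
Qed.

Lemma run_eps_le k : eps k <= Num.max (delta_eps P ^+ k * eps0 P) (eps_d P).
Proof.
have /andP[d0 d1] := delta_eps_in01 HP.
elim: k => [|k IH]; first by rewrite (run_eps0 run) expr0 mul1r le_max lexx.
rewrite (run_eps run) ge_max exprS -mulrA.
apply/andP; split; last by rewrite le_max lexx orbT.
apply: le_trans (_ : _ <= delta_eps P *
  Num.max (delta_eps P ^+ k * eps0 P) (eps_d P)) _.
  by rewrite ler_pM2l.
rewrite (maxr_pMr _ _ (ltW d0)) ge_max !le_max lexx/=.
by rewrite ler_piMl ?orbT ?(eps_d_ge0 HP)// ltW.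
Qed.

Lemma run_eps_ge0 k : 0 <= eps k.
Proof.
case: k => [|k].
  by rewrite (run_eps0 run) (le_trans (eps_d_ge0 HP) (eps0_ge HP)).
by rewrite (run_eps run) le_max (eps_d_ge0 HP) orbT.
Qed.

Let eps_geometric : delta_eps P ^+ k * eps0 P @[k --> \oo] --> (0 : R).
Proof.
have /andP[d0 d1] := delta_eps_in01 HP.
rewrite -[X in _ --> X](mul0r (eps0 P)); apply: cvgM; last exact: cvg_cst.
by apply: cvg_expr; rewrite gtr0_norm.
Qed.

Lemma run_eps_cvg0 : eps_d P = 0 -> eps @ \oo --> (0 : R).
Proof.
move=> ed0; apply: (@squeeze_cvgr _ _ _ _ (fun=> 0)
  (fun k => delta_eps P ^+ k * eps0 P)).
- near=> k; rewrite run_eps_ge0/= (le_trans (run_eps_le k))// ge_max lexx ed0/=.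
  have /andP[d0 d1] := delta_eps_in01 HP.
  apply: mulr_ge0; first exact/exprn_ge0/ltW.
  exact: le_trans (eps_d_ge0 HP) (eps0_ge HP).
- exact: cvg_cst.
- exact: eps_geometric.
Unshelve. all: by end_near. Qed.

Lemma run_eps_eventually : 0 < eps_d P -> \forall k \near \oo, eps k <= eps_d P.
Proof.
move=> ed0; move/cvgr0Pnorm_le/(_ _ ed0) : eps_geometric.
apply: filterS => k; move=> /(le_trans (ler_norm _)) ke.
by rewrite (le_trans (run_eps_le k))// ge_max ke lexx.
Qed.

(* If [mu] does not vanish, then [alpha] is eventually increased at every step,
   which requires [eps_p < p k]. *)
Lemma run_mu_cvg0_or : mu @ \oo --> (0 : R) \/
  \forall k \near \oo, s k <= eps_p P /\ eps_p P < p k.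
Proof.
have [|stat] := cvg0_or_stationary (delta_mu_in01 HP) run_mu_gt0 (run_mu run).
  by left.
right; apply: filterS stat => k; rewrite negb_or -leNgt => /andP[sk aSk].
split => //; move: aSk; rewrite (run_alpha run).
case: ifPn => [pk _|_]; last by rewrite eqxx.
by rewrite -lte_fin (le_lt_trans _ pk)// /infeasibility_threshold le_max lexx.
Qed.

End iterates.

(** * Feasible accumulation points *)

Section slackness_bounds.
Context {R : realType} {n m meq : nat}.
Variables (c : 'rV[R]_n -> 'rV[R]_m) (ceq : 'rV[R]_n -> 'rV[R]_meq).

Lemma pos_ge0 (r : R) : 0 <= pos r.
Proof. by rewrite /pos le_max lexx. Qed.

Lemma neg_ge0 (r : R) : 0 <= neg r.
Proof. by rewrite /neg le_max lexx. Qed.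

Lemma pos_le_norm (r : R) : pos r <= `|r|.
Proof. by rewrite /pos ge_max normr_ge0 ler_norm. Qed.

Lemma neg_le_norm (r : R) : neg r <= `|r|.
Proof. by rewrite /neg ge_max normr_ge0 -normrN ler_norm. Qed.

Lemma norm_min_le (u v e : R) : 0 <= u -> 0 <= v -> u <= e \/ v <= e ->
  `|Num.min u v| <= e.
Proof.
move=> u0 v0 uve; rewrite ger0_norm ?le_min ?u0// ge_min.
by case: uve => ->; rewrite ?orbT.
Qed.

Lemma norm_entry_le (k : nat) (v : 'rV[R]_k) i : `|v ord0 i| <= `|v|.
Proof.
rewrite {2}/Num.Def.normr/= mx_normrE.
exact: (@le_bigmax _ _ _ 0 (fun ij => `|v ij.1 ij.2|) (ord0, i)).
Qed.

Lemma slackness_ge alpha x (y : 'rV[R]_m) (yeq : 'rV[R]_meq) i :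
  Num.min (y ord0 i) (neg (c x ord0 i)) <= slackness c ceq alpha x y yeq.
Proof.
apply: le_trans (ler_norm _) _; rewrite /slackness le_max; apply/orP; left.
apply: le_trans (le_bigmax _ _ i); by rewrite le_max lexx.
Qed.

(** The multiplier bounds make both arguments of every [min] nonnegative, so one small argument
    suffices; infeasibility supplies it except for the pair [y], [neg (c x)]. *)
Lemma slackness_le alpha x (y : 'rV[R]_m) (yeq : 'rV[R]_meq) (e : R) : 0 <= e ->
  (forall i, 0 <= y ord0 i <= alpha) -> (forall j, `|yeq ord0 j| <= alpha) ->
  (forall i, y ord0 i <= e \/ neg (c x ord0 i) <= e) ->
  infeasibility c ceq x <= e ->
  slackness c ceq alpha x y yeq <= e.
Proof.
move=> e0 ya yeqa yc; rewrite /infeasibility ge_max => /andP[ce ceqe].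
have posc i : pos (c x ord0 i) <= e.
  apply: le_trans ce; apply: le_trans (norm_entry_le _ i).
  by rewrite mxE ler_norm.
have ceqje j : `|ceq x ord0 j| <= e := le_trans (norm_entry_le _ j) ceqe.
rewrite /slackness ge_max; apply/andP; split; apply/bigmax_leP; split => // i _.
  have /andP[y0 y1] := ya i; rewrite ge_max; apply/andP; split.
    by apply: norm_min_le => //; exact: neg_ge0.
  by apply: norm_min_le; [rewrite subr_ge0|exact: pos_ge0|right; exact: posc].
have := yeqa i; rewrite ler_norml => /andP[y0 y1]; rewrite ge_max; apply/andP; split.
  apply: norm_min_le; [lra|exact: neg_ge0|right].
  exact: le_trans (neg_le_norm _) (ceqje i).
apply: norm_min_le; [lra|exact: pos_ge0|right].
exact: le_trans (pos_le_norm _) (ceqje i).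
Qed.

End slackness_bounds.

Section feasible_accumulation_point.
Context {R : realType} {n m meq : nat}.
Variables (q : 'rV[R]_n -> \bar R).
Variables (c : 'rV[R]_n -> 'rV[R]_m) (ceq : 'rV[R]_n -> 'rV[R]_meq).
Variables (b : R -> \bar R) (P : alg_params (R := R)).
Variables (x : nat -> 'rV[R]_n) (y : nat -> 'rV[R]_m) (yeq : nat -> 'rV[R]_meq).
Variables (alpha mu eps p s : nat -> R).
Hypothesis Hpb : problem_assumptions q c ceq.
Hypothesis Hb : barrier_assumptions b.
Hypothesis HP : alg_params_assumptions P.
Hypothesis run : runs_indefinitely q c ceq b P x y yeq alpha mu eps p s.
Variables (phi : nat -> nat) (xbar : 'rV[R]_n).
Hypotheses (phi_cvg : phi @ \oo --> \oo) (x_cvg : x \o phi @ \oo --> xbar).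
Hypothesis xbar_feasible : feasible c ceq xbar.

Local Notation beta' := ((fine \o b)^`()%classic).

Let mu_gt0 := run_mu_gt0 HP run.

Let rho_large : \forall k \near \oo, 2 * beta' (-1) < alpha (phi k) / mu (phi k).
Proof. exact: phi_cvg (run_rho_cvgy HP run _). Qed.

Let c_cvg i : c (x (phi k)) ord0 i @[k --> \oo] --> c xbar ord0 i.
Proof.
have cx : c (x (phi k)) @[k --> \oo] --> c xbar.
  have := differentiable_continuous ((c_smooth Hpb).1 xbar).
  exact: (cvg_comp _ _ x_cvg).
exact: (cvg_entry cx).
Qed.

Lemma posv_subsequence_cvg0 : posv (c (x (phi k))) @[k --> \oo] --> (0 : 'rV[R]_m).
Proof.
apply: cvg_mx_entries => j i; rewrite mxE; under eq_fun do rewrite mxE.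
rewrite (ord1 j); apply/cvgr0Pnorm_le => e e0.
have ce : c xbar ord0 i < e by rewrite (le_lt_trans (xbar_feasible.1 i)).
move/cvgrPdist_lt/(_ (e - c xbar ord0 i)) : (c_cvg (i := i)).
rewrite subr_gt0 => /(_ ce); apply: filterS => k.
rewrite ltr_norml => /andP[ck _]; rewrite ger0_norm ?pos_ge0// /pos ge_max ltW//=.
by rewrite ltW//; lra.
Qed.

Lemma ceq_subsequence_cvg0 : ceq (x (phi k)) @[k --> \oo] --> (0 : 'rV[R]_meq).
Proof.
rewrite -xbar_feasible.2.
have := differentiable_continuous ((ceq_smooth Hpb).1 xbar).
exact: (cvg_comp _ _ x_cvg).
Qed.

Lemma infeasibility_subsequence_le e : 0 < e -> \forall k \near \oo, p (phi k) <= e.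
Proof.
move=> e0; have /cvgr0Pnorm_le/(_ _ e0) ce := posv_subsequence_cvg0.
have /cvgr0Pnorm_le/(_ _ e0) := ceq_subsequence_cvg0.
apply: filterS2 ce => k ck ceqk.
by rewrite (run_p run) ge_max ck.
Qed.

Lemma multiplier_subsequence_bounds : \forall k \near \oo,
  [/\ forall i, 0 < y (phi k) ord0 i <= alpha (phi k),
      forall i t, c (x (phi k)) ord0 i <= t -> t < 0 ->
        y (phi k) ord0 i <= mu (phi k) * beta' t &
      forall j, `|yeq (phi k) ord0 j| <= alpha (phi k)].
Proof.
apply: filterS rho_large => k rhok; rewrite (run_y run) (run_yeq run); split.
- move=> i; rewrite multiplier_gt0//=; exact: multiplier_le.
- by move=> i t; exact: multiplier_le_barrier.
- by move=> j; exact: multipliereq_le.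
Qed.

Lemma inactive_multiplier_cvg0 i : c xbar ord0 i < 0 ->
  y (phi k) ord0 i @[k --> \oo] --> (0 : R).
Proof.
(* Half of the limit is a negative bound that the constraint eventually respects. *)
move=> ci0; have t0 : c xbar ord0 i / 2 < 0 by lra.
have ct : \forall k \near \oo, c (x (phi k)) ord0 i <= c xbar ord0 i / 2.
  have ci : 0 < - (c xbar ord0 i / 2) by rewrite oppr_gt0.
  move/cvgrPdist_le/(_ _ ci) : (c_cvg (i := i)); apply: filterS => k.
  by rewrite ler_norml => /andP[? _]; lra.
have [mu0|stat] := run_mu_cvg0_or HP run.
  have muphi : mu (phi k) * beta' (c xbar ord0 i / 2) @[k --> \oo] --> (0 : R).
    rewrite -[X in _ --> X](mul0r (beta' (c xbar ord0 i / 2))).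
    by apply: cvgM; [exact: (cvg_comp _ _ phi_cvg mu0)|exact: cvg_cst].
  apply: squeeze_cvgr (cvg_cst 0) muphi.
  apply: filterS2 multiplier_subsequence_bounds ct => k [yb yt _] ck.
  by have /andP[/ltW -> _] := yb i; exact: yt.
have statphi : \forall k \near \oo, s (phi k) <= eps_p P /\ eps_p P < p (phi k).
  exact: phi_cvg stat.
have ep0 : eps_p P <= 0.
  rewrite leNgt; apply/negP => /infeasibility_subsequence_le pphi.
  have [k [[_ pk]]] := filter_ex (filterI statphi pphi).
  by rewrite leNgt pk.
(* This branch is contradictory at a single index: [s <= 0], yet both arguments of the [min] for [i]
   are positive. *)
have [k [[[sk _] [yb _ _]] ck]] :=
  filter_ex (filterI (filterI statphi multiplier_subsequence_bounds) ct).
have /andP[y0 _] := yb i.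
have := slackness_ge c ceq (alpha (phi k)) (x (phi k)) (y (phi k)) (yeq (phi k)) i.
rewrite -(run_s run) => /le_trans/(_ sk)/le_trans/(_ ep0).
by rewrite ge_min leNgt y0/= /neg ge_max lexx/= oppr_le0 leNgt (le_lt_trans ck).
Qed.

(** Active constraints have [neg (c x)] small by continuity; inactive ones have small
    multipliers. *)
Lemma slackness_subsequence_le e : 0 < e -> \forall k \near \oo, s (phi k) <= e.
Proof.
move=> e0; have ye : \forall k \near \oo, forall i,
    y (phi k) ord0 i <= e \/ neg (c (x (phi k)) ord0 i) <= e.
  apply: filter_forall => i; have [ci|ci] := ltP (c xbar ord0 i) 0.
    move/cvgr0Pnorm_le/(_ _ e0) : (inactive_multiplier_cvg0 ci).
    by apply: filterS => k /(le_trans (ler_norm _)); left.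
  move/cvgrPdist_le/(_ _ e0) : (c_cvg (i := i)); apply: filterS => k.
  by rewrite ler_norml => /andP[_ ?]; right; rewrite /neg ge_max ltW//=; lra.
have ipe := infeasibility_subsequence_le e0.
apply: filterS3 multiplier_subsequence_bounds ye ipe => k [yb _ yeqb] yk pk.
rewrite (run_s run); apply: slackness_le => //.
- exact: ltW.
- by move=> i; have /andP[/ltW -> ->] := yb i.
- by rewrite -(run_p run).
Qed.

(** [eps_d > 0] would force [eps_p > 0], and then all three stopping tests hold at a common
    [phi k]. *)
Lemma run_eps_d0 : (eps_p P = 0 -> eps_d P = 0) -> eps_d P = 0.
Proof.
move=> epd; apply/eqP; have := eps_d_ge0 HP; rewrite le_eqVlt eq_sym => /orP[//|ed0].
have ep0 : 0 < eps_p P.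
  rewrite lt_neqAle (eps_p_ge0 HP) andbT eq_sym; apply/eqP => /epd ed.
  by rewrite ed ltxx in ed0.
have epsphi : \forall k \near \oo, eps (phi k) <= eps_d P.
  exact: phi_cvg (run_eps_eventually HP run ed0).
have [k [epsk [pk sk]]] := filter_ex (filterI epsphi
  (filterI (infeasibility_subsequence_le ep0) (slackness_subsequence_le ep0))).
by case: (@run_nostop _ _ _ _ _ _ _ _ _ _ _ _ _ _ _ _ _ run (phi k)).
Qed.

Lemma accumulation_point_KKT : eps_d P = 0 -> dom q xbar ->
  asymptotically_KKT_optimal q c ceq xbar.
Proof.
move=> ed0 qx; split => //.
(* Positivity of [y] is known only for large [k]; [pos] enforces the sign demanded at every [k]. *)
pose eta k : 'rV[R]_m :=
  \row_i if c xbar ord0 i == 0 then pos (y (phi k) ord0 i) else 0.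
exists (x \o phi), eta, (yeq \o phi); split => //; last first.
- move=> k i; rewrite mxE; case: eqP => [->|_]; last by rewrite lexx mul0r.
  by rewrite mulr0 pos_ge0.
- exact: ceq_subsequence_cvg0.
- exact: posv_subsequence_cvg0.
(* The slack [1 / (k + 1)] yields a subgradient from the infimum alone and vanishes in the limit. *)
have /choice[v vP] k : exists v,
    subdifferential (penalty_barrier q c ceq b (alpha k) (mu k)) (x k) v /\
    enorm v <= eps k + k.+1%:R^-1.
  have : (dist 0 (subdifferential (penalty_barrier q c ceq b (alpha k) (mu k)) (x k))
      < (eps k + k.+1%:R^-1)%:E)%E.
    by rewrite (le_lt_trans (run_x run k))// lte_fin ltrDl invr_gt0.
  move=> /ereal_inf_lt[_ [v vF <-]]; rewrite lte_fin => vk; exists v; split => //.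
  apply: ltW; move: vk; rewrite /enorm sub0r.
  by rewrite /inner; under eq_bigr do rewrite mxE mulrNN.
have v_cvg : v \o phi @ \oo --> (0 : 'rV[R]_n).
  suff : v @ \oo --> (0 : 'rV[R]_n) by exact: cvg_comp.
  apply: norm_cvg0.
  apply: (@squeeze_cvgr _ _ _ _ (fun=> 0) (fun k => eps k + k.+1%:R^-1)).
  - apply: nearW => k.
    by rewrite normr_ge0/= (le_trans (norm_le_enorm _))// (vP k).2.
  - exact: cvg_cst.
  - rewrite -[X in _ --> X](addr0 0); apply: cvgD; last exact: cvg_harmonic.
    exact: (run_eps_cvg0 HP run ed0).
have eta_cvg : y (phi k) - eta k @[k --> \oo] --> (0 : 'rV[R]_m).
  apply: cvg_mx_entries => j i; rewrite (ord1 j) mxE.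
  under eq_fun do rewrite !mxE.
  case: eqP => [_|/eqP ci].
    apply: cvg_near_cst; apply: filterS multiplier_subsequence_bounds => k [yb _ _].
    by have /andP[y0 _] := yb i; rewrite /pos max_r ?subrr// ltW.
  under eq_fun do rewrite subr0.
  by apply: inactive_multiplier_cvg0; rewrite lt_neqAle ci xbar_feasible.1.
(* [w k] is the asymptotic KKT vector minus the subgradient of [q] obtained from [v]. The terms in
   [yeq] cancel and [y] enters only through [y - eta], so [w] vanishes even if the multipliers are
   unbounded. *)
pose w k := (y (phi k) - eta k) *m ('J c (x (phi k)))^T - v (phi k).
have w_cvg : w @ \oo --> (0 : 'rV[R]_n).
  rewrite -[X in _ --> X](subr0 0); apply: cvgB => //.
  rewrite -[X in _ --> X](mul0mx _ ('J c xbar)^T); apply: cvg_mulmx => //.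
  apply: cvg_trmx; exact: (cvg_comp _ _ x_cvg ((c_smooth Hpb).2 xbar)).
have we : (fun k => (enorm (w k))%:E) @ \oo --> 0%E.
  apply: cvg_EFin; first exact: nearW.
  exact: cvg_enorm0.
apply: squeeze_cvge (cvg_cst 0%E) we.
apply: filterS rho_large => k rhok; apply/andP; split.
  by apply: le_ereal_inf_tmp => _ [u _ <-]; rewrite lee_fin enorm_ge0.
have := subdifferential_penalty_barrier (c_smooth Hpb) (ceq_smooth Hpb) Hb
  rhok (vP (phi k)).1.
rewrite -(run_y run) -(run_yeq run) => qw.
apply: ereal_inf_lbound; exists (v (phi k) - (jacT c (x (phi k)) (y (phi k))
  + jacT ceq (x (phi k)) (yeq (phi k)))) => //.
congr (enorm _)%:E; rewrite /w /jacT mulmxBl /=.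
move: (y _ *m _) (eta k *m _) (yeq _ *m _) (v _) => A B C D.
by apply/matrixP => i j; rewrite !mxE; lra.
Qed.

End feasible_accumulation_point.

(** The decrease is eventual: for small ratios [b^*] can be infinite, or [b] nonpositive at the
    maximizer. The condition on the tolerances excludes [eps_p = 0 < eps_d]: such a run need not
    stop, while [eps k >= eps_d] keeps the stationarity bound away from [0]. *)
Theorem corollary4p4 (R : realType) (n m meq : nat)
    (q : 'rV[R]_n -> \bar R)
    (c : 'rV[R]_n -> 'rV[R]_m) (ceq : 'rV[R]_n -> 'rV[R]_meq)
    (b : R -> \bar R) (P : alg_params (R := R))
    (x : nat -> 'rV[R]_n) (y : nat -> 'rV[R]_m) (yeq : nat -> 'rV[R]_meq)
    (alpha mu eps p s : nat -> R) :
  problem_assumptions q c ceq ->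
  barrier_assumptions b ->
  alg_params_assumptions P ->
  runs_indefinitely q c ceq b P x y yeq alpha mu eps p s ->
  [/\ (fun k => scaled_conjugate b (alpha k) (mu k)) @ \oo --> 0%E,
      (\forall k \near \oo,
         (scaled_conjugate b (alpha k.+1) (mu k.+1)
            < scaled_conjugate b (alpha k) (mu k))%E) &
      (eps_p P = 0 -> eps_d P = 0) ->
      forall xbar : 'rV[R]_n,
        cluster (x @ \oo) xbar ->
        feasible c ceq xbar ->
        dom q xbar ->
        asymptotically_KKT_optimal q c ceq xbar].
Proof.
move=> Hpb Hb HP run; split.
- exact: (scaled_conjugate_cvg0 Hb (run_alpha_gt0 HP run) (run_mu_gt0 HP run)
    (run_rho_cvgy HP run)).
- exact: (scaled_conjugate_decreasing Hb (run_alpha_gt0 HP run) (run_mu_gt0 HP run)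
    (run_rho_cvgy HP run) (run_rho_increasing HP run)).
move=> epd xbar /cluster_subsequence[phi phi_cvg x_cvg] xbar_feasible qx.
have ed0 := run_eps_d0 Hpb Hb HP run phi_cvg x_cvg xbar_feasible epd.
exact: (accumulation_point_KKT Hpb Hb HP run phi_cvg x_cvg xbar_feasible ed0 qx).
Qed.
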